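(* Let $\vec U=(\vec U,\le,{}^*,\vee,\wedge,|\ |)$ be a submodular universe of separations. For every robust set $\mathcal P$ of regular profiles in $\vec U$ there is a regular tree set $T'\subseteq U$ of separations (with set $\vec T'\subseteq\vec U$ of orientations) such that: (i) every two profiles in $\mathcal P$ are efficiently distinguished by some separation in $T'$; (ii) no proper subset of $T'$ distinguishes $\mathcal P$; (iii) for every $P\in\mathcal P$ the set $P\cap\vec T'$ extends to a unique consistent orientation $P_{T'}$ of $T'$, and this map $P\mapsto P_{T'}$ from $\mathcal P$ to the set $\mathcal O$ of consistent orientations of $T'$ is bijective.
   Context: A separation system $(\vec S,\le,{}^* )$ is a partially ordered set $\vec S$ with an order-reversing involution $^*$. Its elements $\vec s$ are oriented separations, $\vec s^{\,*}$ is the inverse of $\vec s$, and $s=\{\vec s,\vec s^{\,*}\}$ is the corresponding (unoriented) separation with orientations $\vec s,\vec s^{\,*}$; $S$ denotes the set of all these $s$, and for $R\subseteq S$, $\vec R$ is the set of all orientations of elements of $R$. $\vec s$ (and $s$) is degenerate if $\vec s=\vec s^{\,*}$; $\vec s$ is small if $\vec s\le\vec s^{\,*}$; $\vec r\in\vec S$ is trivial in $\vec S$ if there is $s\in S$ with $\vec r<\vec s$ and $\vec r<\vec s^{\,*}$. A universe of separations is a separation system $\vec U$ with binary operations $\vee,\wedge$ giving suprema and infima in $\vec U$. It is submodular if it comes with an order function $\vec s\mapsto|\vec s|\in\mathbb R$ satisfying $0\le|\vec s|=|\vec s^{\,*}|=:|s|$ and $|\vec r\vee\vec s|+|\vec r\wedge\vec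 s|\le|\vec r|+|\vec s|$ for all $\vec r,\vec s\in\vec U$. Separations $r,s$ are nested if they have comparable orientations; a set of separations is nested if every two elements are. A tree set is a set $T$ of separations that is nested and such that $\vec T$ has no element that is degenerate or trivial in $\vec T$; it is regular if no element of $\vec T$ is small. For $k>0$ put $\vec S_k=\{\vec s\in\vec U:|\vec s|<k\}$. An orientation of a separation system $\vec S$ (or of $S$) is a set $O\subseteq\vec S$ with $O\cup O^*=\vec S$ and $|O\cap\{\vec s,\vec s^{\,*}\}|=1$ for all $s\in S$, where $O^*=\{\vec s^{\,*}:\vec s\in O\}$. A set $O\subseteq\vec S$ is consistent if there are no distinct $r,s\in S$ with orientations $\vec r<\vec s$ such that $\vec r^{\,*},\vec s\in O$. For $\vec S\subseteq\vec U$, a profile of $S$ is a consistent orientation $P$ of $S$ such that $(\vec r\vee\vec s)^*\notin P$ for all $\vec r,\vec s\in P$. It is regular if it contains no separation whose inverse is small. A $k$-profile in $\vec U$, for an integer $k>0$, is a profile of $S_k$; a profile in $\vec U$ is a $k$-profile in $\vec U$ for some $k$. A non-degenerate $s\in U$ distinguishes profiles $P,P'$ if it has an orientation $\vec s\in P$ with $\vec s^{\,*}\in P'$. A set of separations distinguishes $\mathcal P$ if every two distinct elements of $\mathcal P$ are distinguished by some element of the set. $P,P'$ are distinguishable if some $s\in U$ distinguishes them; $\kappa(P,P')$ is then the smallest $k$ such that some separation of order at most $k$ distinguishes them, and $s$ distinguishes $P,P'$ efficiently if it distinguishes them and $|s|=\kappa(P,P')$. A profile $P$ is $n$-robust if for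 every $\vec r\in P$ and every $s\in S_n$ (i.e. $|s|<n$): if $\vec r^{\,*}\wedge\vec s$ and $\vec r^{\,*}\wedge\vec s^{\,*}$ both have order $<|r|$, they do not both lie in $P$. Two profiles $P,P'$ in $\vec U$ are $n$-robustly distinguishable if they are distinguishable and the distinct profiles $P\cap\vec S_k$ and $P'\cap\vec S_k$ they induce for $k=\kappa(P,P')+1$ are both $n$-robust. A set $\mathcal P$ of profiles in $\vec U$ is $n$-robust if any distinct $P,P'\in\mathcal P$ are $n$-robustly distinguishable and satisfy $\kappa(P,P')<n$. A set $\mathcal P$ of pairwise distinguishable profiles is robust if it is $n$-robust for $n=\max\{\kappa(P,P'):P,P'\in\mathcal P\text{ distinct}\}+1$.
   Formalization: The set P of profiles is assumed finite and non-empty; for empty P, and for some infinite P (e.g. the 2-profiles pointing to the vertices of a one-way infinite path), (iii) fails. The universe itself may be infinite. *)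

(* Defs.v *)
From HB Require Import structures.
From mathcomp Require Import all_boot all_order all_algebra.
From mathcomp Require Import boolp classical_sets functions cardinality reals.

Set Implicit Arguments.
Unset Strict Implicit.
Unset Printing Implicit Defensive.

Import Order.TTheory GRing.Theory Num.Theory.

Local Open Scope classical_set_scope.
Local Open Scope ring_scope.

HB.mixin Record hasSepInv (d : Order.disp_t) U of Order.POrder d U := {
  inv : U -> U;
  invK : involutive inv;
  inv_anti : forall r s : U, (r <= s)%O -> (inv s <= inv r)%O
}.

#[short(type="sepSystemType")]
HB.structure Definition SepSystem d := {U of hasSepInv d U & Order.POrder d U}.

#[short(type="universeType")]
HB.structure Definition Universe d := {U of SepSystem d U & Order.Lattice d U}.

(* The elements of a separation system are the oriented separations.  An
   unoriented separation is the set [unor s] = {s, inv s}; properties of an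
   unoriented separation are stated for an arbitrary orientation s of it.
   A separation system inside U is given by the set of its orientations. *)
Section SeparationSystems.
Context {d : Order.disp_t} {U : sepSystemType d}.
Implicit Types (r s : U) (V O P : set U) (T : set (set U)).

Definition unor s : set U := [set s; inv s].

Definition separations : set (set U) := range unor.

Definition orientations T : set U := [set s | T (unor s)].

Definition degenerate s : Prop := s = inv s.

Definition small s : Prop := (s <= inv s)%O.

Definition trivial_in V r : Prop :=
  V r /\ exists2 s, V s & (r < s)%O /\ (r < inv s)%O.

Definition nested r s : Prop :=
  exists2 a, unor r a & exists2 b, unor s b & (a >=< b)%O.

Definition tree_set T : Prop :=
  [/\ T `<=` separations,
      forall r s, T (unor r) -> T (unor s) -> nested r s
    & forall s, orientations T s ->
        ~ degenerate s /\ ~ trivial_in (orientations T) s].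

Definition regular_tree_set T : Prop :=
  tree_set T /\ forall s, orientations T s -> ~ small s.

Definition orientation_of V O : Prop :=
  [/\ O `<=` V, O `|` (inv @` O) = V
    & forall s, V s -> exists! a, (O `&` unor s) a].

Definition consistent O : Prop :=
  forall r s, unor r <> unor s -> (r < s)%O -> ~ (O (inv r) /\ O s).

Definition consistent_orientations T : set (set U) :=
  [set O | orientation_of (orientations T) O /\ consistent O].

Definition distinguishes s P P' : Prop :=
  ~ degenerate s /\ exists2 a, unor s a & P a /\ P' (inv a).

Definition distinguishes_set T (PP : set (set U)) : Prop :=
  forall P P', PP P -> PP P' -> P <> P' ->
    exists2 s, T (unor s) & distinguishes s P P'.

Definition distinguishable P P' : Prop := exists s, distinguishes s P P'.

Definition regular P : Prop := forall s, P s -> ~ small (inv s).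

End SeparationSystems.

Section SubmodularUniverses.
Context {R : realType} {d : Order.disp_t} {U : universeType d}.
Variable ord : U -> R.
Implicit Types (r s : U) (P : set U) (PP : set (set U)).

Definition submodular_order : Prop :=
  [/\ forall s, 0 <= ord s, forall s, ord (inv s) = ord s
    & forall r s, ord (Order.join r s) + ord (Order.meet r s)
                  <= ord r + ord s].

Definition sep_below (k : R) : set U := [set s | ord s < k].

Definition profile (V P : set U) : Prop :=
  [/\ orientation_of V P, consistent P
    & forall r s, P r -> P s -> ~ P (inv (Order.join r s))].

Definition profile_in_universe P : Prop :=
  exists2 k : nat, (0 < k)%N & profile (sep_below k%:R) P.

Definition least (A : set R) (k : R) : Prop := A k /\ lbound A k.

Definition greatest (A : set R) (k : R) : Prop := A k /\ ubound A k.

(* kappa(P, P') = k, as a relation: in an infinite universe the minimum that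
   defines kappa need not be attained. *)
Definition is_kappa P P' (k : R) : Prop :=
  least [set l | exists2 s, ord s <= l & distinguishes s P P'] k.

Definition distinguishes_efficiently s P P' : Prop :=
  distinguishes s P P' /\ is_kappa P P' (ord s).

Definition robust_profile (n : R) P : Prop :=
  forall r s, P r -> ord s < n ->
    ord (Order.meet (inv r) s) < ord r ->
    ord (Order.meet (inv r) (inv s)) < ord r ->
    ~ (P (Order.meet (inv r) s) /\ P (Order.meet (inv r) (inv s))).

(* The restrictions of P and P' below kappa + 1 are automatically distinct,
   since a separation of order kappa distinguishes them. *)
Definition robustly_distinguishable (n : R) P P' : Prop :=
  distinguishable P P' /\
  exists2 k, is_kappa P P' k &
    robust_profile n (P `&` sep_below (k + 1)) /\
    robust_profile n (P' `&` sep_below (k + 1)).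

Definition n_robust (n : R) PP : Prop :=
  forall P P', PP P -> PP P' -> P <> P' ->
    robustly_distinguishable n P P' /\ exists2 k, is_kappa P P' k & k < n.

Definition kappas PP : set R :=
  [set k | exists P P', [/\ PP P, PP P', P <> P' & is_kappa P P' k]].

(* If PP has at most one element, there is no kappa to take the maximum of,
   and PP is (vacuously) n-robust for every n. *)
Definition robust PP : Prop :=
  (forall P P', PP P -> PP P' -> P <> P' -> distinguishable P P') /\
  (is_subset1 PP \/ exists2 m, greatest (kappas PP) m & n_robust (m + 1) PP).

End SubmodularUniverses.

(* Main.v *)
Require Import Defs.
From mathcomp Require Import all_boot all_order all_algebra.
From mathcomp Require Import boolp classical_sets functions cardinality reals.
From mathcomp Require Import lra.

(** The tree set is assembled from efficient distinguishers, and everything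
beyond nestedness is a matter of counting.

Nestedness.  Take the pairs of profiles in order of increasing kappa, and keep a
finite nested set [N] that efficiently distinguishes the pairs taken so far.  For
the next pair (Q, Q') choose an efficient distinguisher [s] that crosses as few
elements of [N] as possible.  Suppose that [s] crosses [r], an element of [N]
that efficiently distinguishes (P, P').  As |r| <= |s|, both Q and Q' orient [r].
If they orient it differently, then [r] itself serves the pair (Q, Q').  If both
contain [r], say, and [r] is in P, then one of the corners [r \/ s] and
[r \/ s^*] has order at most |s| and thus still distinguishes Q from Q'
efficiently: otherwise submodularity makes the opposite corners [r /\ s] and
[r /\ s^*] smaller than |r|, so that P and P' orient both of them alike, which
contradicts the robustness of P' at [r^*] ([efficient_or_corner]).  By the fish
lemma ([nested_corner]) this corner crosses fewer elements of [N] than [s] does;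
so a best choice of [s] crosses nothing ([nested_transversal]).

Counting.  A smallest such [N] satisfies |N| < |PP|.  Indeed each element of it
is then the only one that efficiently distinguishes some private pair, and
splitting the set of profiles along an element of least order shows that private
pairs form a forest ([size_private_pairs]).  Dually, a nested set with m elements
has at most m + 1 consistent orientations ([size_consistent_orientations]).
Every profile P extends to a consistent orientation of the tree set
([extension_orientation]), and different profiles to different ones, so these
two bounds leave no room.  Every consistent orientation extends a profile; and a
proper subset cannot distinguish all the profiles, since it has too few consistent
orientations. *)

Set Implicit Arguments.
Unset Strict Implicit.
Unset Printing Implicit Defensive.

Import Order.TTheory GRing.Theory Num.Theory.

Local Open Scope classical_set_scope.
Local Open Scope ring_scope.

Local Notation inv := Defs.inv.
Local Notation invK := Defs.invK.

(** * Sizes of filtered lists *)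

Lemma size_filter_lt (I : eqType) (a : pred I) (s : seq I) x :
  x \in s -> ~~ a x -> (size (filter a s) < size s)%N.
Proof.
move=> xs ax; rewrite size_filter -(count_predC a s) -addn1 leq_add2l -has_count.
by apply/hasP; exists x.
Qed.

Lemma size_filter_split (I : Type) (a : pred I) (s : seq I) :
  size s = (size [seq x <- s | a x == true] +
            size [seq x <- s | a x == false])%N.
Proof.
rewrite !size_filter -(count_predC a); congr addn; apply: eq_count => x /=.
  by case: (a x).
by case: (a x).
Qed.

(** * Nestedness and regular consistent orientations *)

Section SeparationSystems.
Context {d : Order.disp_t} {U : sepSystemType d}.
Implicit Types (r s t : U) (V O P : set U).

Lemma le_inv r s : (inv r <= inv s)%O = (s <= r)%O.
Proof.
apply/idP/idP => [h|]; last exact: inv_anti.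
by rewrite -(invK r) -(invK s); exact: inv_anti.
Qed.

Lemma le_invl r s : (inv r <= s)%O = (inv s <= r)%O.
Proof. by rewrite -le_inv invK. Qed.

Lemma le_invr r s : (r <= inv s)%O = (s <= inv r)%O.
Proof. by rewrite -le_inv invK. Qed.

Lemma unor_inv s : unor (inv s) = unor s.
Proof. by rewrite /unor invK setUC. Qed.

Lemma unor_eqP r s : unor r = unor s <-> r = s \/ r = inv s.
Proof.
split=> [e|[->//|->]]; last exact: unor_inv.
by have : unor s r by rewrite -e; left.
Qed.

Lemma nestedP r s : nested r s <->
  [\/ (r <= s)%O, (r <= inv s)%O, (inv r <= s)%O | (inv r <= inv s)%O].
Proof.
split=> [[a [] -> [b [] -> /orP[]]]|[] h].
- by constructor 1.
- by move=> h; constructor 4; rewrite le_inv.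
- by constructor 2.
- by move=> h; constructor 3; rewrite le_invl.
- by constructor 3.
- by move=> h; constructor 2; rewrite le_invr.
- by constructor 4.
- by rewrite le_inv => h; constructor 1.
- by exists r; [left|exists s; [left|apply/orP; left]].
- by exists r; [left|exists (inv s); [right|apply/orP; left]].
- by exists (inv r); [right|exists s; [left|apply/orP; left]].
- by exists (inv r); [right|exists (inv s); [right|apply/orP; left]].
Qed.

Lemma nested_sym r s : nested r s -> nested s r.
Proof.
case=> a ra [b sb ab].
by exists b => //; exists a => //; rewrite comparable_sym.
Qed.

Lemma nested_refl s : nested s s.
Proof. by apply/nestedP; constructor 1. Qed.

Lemma nested_inv r s : nested r (inv s) <-> nested r s.
Proof. by rewrite /nested unor_inv. Qed.

(** The profiles of the theorem and the consistent orientations of a regular tree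
set are both of this kind; all that is used of either is that they contain exactly
one orientation of each separation and are closed downwards in [V]. *)
Definition regular_orientation V P : Prop :=
  [/\ orientation_of V P, consistent P & regular P].

Section RegularOrientation.
Variables (V P : set U) (hP : regular_orientation V P).

Lemma ro_sub : P `<=` V.
Proof. by case: hP => -[]. Qed.

Lemma ro_inv s : V s -> V (inv s).
Proof.
case: hP => -[PV cover _] _ _; rewrite -cover => -[Ps|[t Pt <-]].
  by right; exists s.
by left; rewrite invK.
Qed.

Lemma ro_total s : V s -> P s \/ P (inv s).
Proof. by case: hP => -[_ <- _] _ _ [|[t Pt <-]]; rewrite ?invK; [left|right]. Qed.

Lemma ro_excl s : P s -> ~ P (inv s).
Proof.
case: hP => -[PV _ one] _ reg Ps Pis.
have [a [_ ua]] := one s (PV s Ps).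
have e1 : a = s by apply: ua; split=> //; left.
have e2 : a = inv s by apply: ua; split=> //; right.
by case: (reg s Ps); rewrite /small invK -e2 e1.
Qed.

(** Regularity covers the case that consistency leaves open, where [r] and [s]
are the two orientations of the same separation. *)
Lemma ro_down r s : V r -> (r <= s)%O -> P s -> P r.
Proof.
move=> Vr; rewrite le_eqVlt => /orP[/eqP->//|rs Ps].
have [//|Pir] := ro_total Vr.
case: hP => _ con reg; exfalso.
have [/unor_eqP[e|e]|ne] := pselect (unor r = unor s).
- by move: rs; rewrite e ltxx.
- by case: (reg s Ps); rewrite /small invK -e ltW.
- by case: (con r s ne rs).
Qed.

End RegularOrientation.

Lemma regular_orientationI V P : P `<=` V ->
  (forall s, V s -> V (inv s)) -> (forall s, V s -> ~ small s) ->
  (forall s, V s -> P s \/ P (inv s)) -> (forall s, P s -> ~ P (inv s)) ->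
  (forall r s, V r -> (r <= s)%O -> P s -> P r) -> regular_orientation V P.
Proof.
move=> PV Vinv Vreg tot excl down; split; first split=> //.
- rewrite eqEsubset; split=> [s [/PV//|[t /PV/Vinv Vt <-]//]|s Vs].
  by have [|Pis] := tot s Vs; [left|right; exists (inv s); rewrite ?invK].
- move=> s Vs; have [Ps|Ps] := tot s Vs.
    exists s; split=> [|a [Pa [->//|e]]]; first by split=> //; left.
    by move: Pa; rewrite e => /(excl s Ps).
  exists (inv s); split=> [|a [Pa [e|->//]]]; first by split=> //; right.
  by move: Pa; rewrite e => /excl /(_ Ps).
- move=> r s _ /ltW rs [Pir Ps].
  apply: (excl r) => //; apply: down Ps => //.
  by rewrite -(invK r); apply/Vinv/PV.
- by move=> s /PV/Vinv/Vreg.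
Qed.

Lemma distinguishes_cases s P P' : distinguishes s P P' ->
  P s /\ P' (inv s) \/ P (inv s) /\ P' s.
Proof. by case=> _ [a [] -> []]; rewrite ?invK; [left|right]. Qed.

Lemma distinguishes_sym s P P' : distinguishes s P P' -> distinguishes s P' P.
Proof.
case=> nd [a us [Pa P'a]]; split=> //; exists (inv a); rewrite ?invK //.
by case: us => ->; [right|left; rewrite invK].
Qed.

Lemma distinguishes_inv s P P' :
  distinguishes s P P' -> distinguishes (inv s) P P'.
Proof.
case=> nd h; split; last by rewrite unor_inv.
by move=> e; apply: nd; rewrite /degenerate {1}e invK.
Qed.

Lemma distinguishesI s P P' :
  regular P -> P s -> P' (inv s) -> distinguishes s P P'.
Proof.
move=> regP Ps P's; split; last by exists s; [left|].
by move=> e; case: (regP s Ps); rewrite /small invK -e.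
Qed.

Lemma not_distinguishes_self V O s :
  regular_orientation V O -> ~ distinguishes s O O.
Proof.
by move=> ro /distinguishes_cases[[Os]|[+ Os]]; exact: (ro_excl ro Os).
Qed.

Lemma distinct_orientations_distinguished V O O' :
  regular_orientation V O -> regular_orientation V O' -> O <> O' ->
  exists2 s, V s & distinguishes s O O'.
Proof.
move=> ro ro' ne; apply: contrapT => none; apply: ne.
apply/seteqP; split=> s Os.
  have Vs := ro_sub ro Os; have [//|O's] := ro_total ro' Vs.
  by case: none; exists s => //; apply: distinguishesI => //; case: ro.
have Vs := ro_sub ro' Os; have [//|O's] := ro_total ro Vs.
case: none; exists s => //.
by apply/distinguishes_sym/distinguishesI => //; case: ro'.
Qed.

(** Split the orientations along a separation [s] of [N].  Another element [t] of
[N] cannot distinguish two orientations on both sides: [s] and [t] have comparable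
orientations, so one orientation of [s] forces an orientation of [t].  By
induction each side has at most one orientation more than there are elements of
[N] that distinguish two of its members, and these elements are all different and
different from [s]. *)
Lemma size_consistent_orientations V (N : seq U) (os : seq (set U)) :
  (forall r s, r \in N -> s \in N -> nested r s) ->
  (forall s, s \in N -> V s) ->
  uniq os -> (forall O, O \in os -> regular_orientation V O) ->
  (forall O O', O \in os -> O' \in os -> O <> O' ->
     exists2 s, s \in N & distinguishes s O O') ->
  (size os <= (size N).+1)%N.
Proof.
have [n] := ubnP (size N).
elim: n N os => // n IHn [|s N] os lt nest NV uos ro dist.
  case: os uos {ro} dist => [|O [|O' os]] //= /andP[/[!inE]/norP[/eqP ne _] _].
  by move=> /(_ O O'); rewrite !inE !eqxx orbT => -[].
(* [side true] consists of the orientations that contain [s]. *)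
pose side (b : bool) := [pred O : set U | `[< O s >] == b].
pose Ns b := [pred t : U |
  `[< exists O O', [/\ O \in os, O' \in os, side b O, side b O'
                     & O t /\ O' (inv t)] >]].
have Vs : V s by apply: NV; rewrite mem_head.
have sizes b : (size (filter (side b) os) <= (size (filter (Ns b) N)).+1)%N.
  apply: IHn; rewrite ?filter_uniq //.
  - by rewrite (leq_ltn_trans (size_subseq (filter_subseq _ _))).
  - by move=> x y; rewrite !mem_filter => /andP[_ xN] /andP[_ yN];
      apply: nest; rewrite inE ?xN ?yN orbT.
  - by move=> x; rewrite mem_filter => /andP[_ xN]; apply: NV; rewrite inE xN orbT.
  - by move=> O; rewrite mem_filter => /andP[_ /ro].
  - move=> O O'; rewrite !mem_filter => /andP[sO Oos] /andP[sO' O'os] ne.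
    have [t tN dt] := dist _ _ Oos O'os ne; exists t => //.
    have roO := ro _ Oos; have roO' := ro _ O'os.
    move/distinguishes_cases: dt => dt.
    move: tN; rewrite mem_filter inE => /orP[/eqP e|->]; last first.
      rewrite andbT; apply/asboolP; case: dt => -[? ?].
        by exists O, O'.
      by exists O', O.
    (* [s] itself does not distinguish two orientations on the same side. *)
    exfalso; subst t; move: sO sO' => /= /eqP <- /eqP.
    case: dt => -[Os O's].
      by rewrite (asboolT Os) asboolF // => /(ro_excl roO').
    by rewrite (asboolT O's) asboolF // => /(ro_excl roO).
have disj : (size (filter (Ns true) N) + size (filter (Ns false) N) <= size N)%N.
  rewrite !size_filter -count_predUI addnC.
  rewrite (@eq_in_count _ _ pred0) ?count_pred0 ?count_size // => t tN /=.
  apply/negP => /andP[].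
  case/asboolP => O1 [O2 [i1 i2 /eqP/asboolP b1 /eqP/asboolP b2 [h1 h2]]].
  case/asboolP => O3 [O4 [i3 i4 /eqP/asboolPn b3 /eqP/asboolPn b4 [h3 h4]]].
  have Vis := ro_inv (ro _ i1) Vs.
  have /nestedP : nested s t by apply: nest; rewrite inE ?eqxx ?tN ?orbT.
  case=> le.
  - by apply: b3; apply: (ro_down (ro _ i3)) le h3.
  - by apply: b4; apply: (ro_down (ro _ i4)) le h4.
  - by apply: (ro_excl (ro _ i1) b1); apply: (ro_down (ro _ i1)) le h1.
  - by apply: (ro_excl (ro _ i2) b2); apply: (ro_down (ro _ i2)) le h2.
rewrite (size_filter_split (fun O : set U => `[< O s >]) os) /=
  (leq_trans (leq_add (sizes true) (sizes false))) //.
by rewrite addSn addnS.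
Qed.

(** * Extending a profile to the whole tree set *)

Section Extension.
Variables (V W P0 P : set U).
Hypothesis roP0 : regular_orientation V P0.
Hypothesis roP : regular_orientation W P.
Variables (T : set U).
Hypothesis TV : T `<=` V.
Hypothesis Tinv : forall s, T s -> T (inv s).
Hypothesis Treg : forall s, T s -> ~ small s.

(** [P] need not orient every separation in [T].  Those whose orientation is not
forced by [P] are oriented as in one fixed orientation [P0] of all of [T]. *)
Definition forced s := exists2 x, P x & (s <= x)%O.

Definition extension : set U :=
  [set s | T s /\ (forced s \/ ~ forced (inv s) /\ P0 s)].

Lemma extension_sub : P `&` T `<=` extension.
Proof. by move=> s [Ps Ts]; split=> //; left; exists s. Qed.

Lemma forced_excl s : forced s -> ~ forced (inv s).
Proof.
move=> [x Px sx] [y Py sy]; apply: (ro_excl roP Py).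
apply: (ro_down roP) Px; first exact: (ro_inv roP (ro_sub roP Py)).
by rewrite (le_trans _ sx) // le_invl.
Qed.

Lemma extension_orientation : regular_orientation T extension.
Proof.
apply: regular_orientationI => //.
- by move=> s [].
- move=> s Ts.
  have Tis := Tinv Ts.
  have [fs|nfs] := pselect (forced s); first by left; split=> //; left.
  have [fs|nfis] := pselect (forced (inv s)); first by right; split=> //; left.
  have [?|?] := ro_total roP0 (TV Ts); [left|right]; split=> //; right=> //.
  by rewrite invK.
- move=> s [Ts h] [_]; rewrite invK; case: h => [fs|[nfs P0s]].
    by case=> [/(forced_excl fs)//|[/(_ fs)]].
  by case=> [/nfs//|[_]]; exact: (ro_excl roP0 P0s).
- move=> r s Tr rs [Ts h]; split=> //.
  have fdown x y : (x <= y)%O -> forced y -> forced x.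
    by move=> xy [z Pz yz]; exists z => //; exact: le_trans yz.
  case: h => [/(fdown _ _ rs)|[nfs P0s]]; [by left|right; split].
    by move=> fr; apply/nfs/(fdown _ _ _ fr); rewrite le_inv.
  exact: (ro_down roP0 (TV Tr) rs).
Qed.

End Extension.

End SeparationSystems.

(** * Corners of crossing separations *)

Section Corners.
Context {d : Order.disp_t} {U : universeType d}.
Implicit Types r s t c : U.
Local Notation join := Order.join.

(** The fish lemma.  If [t] is nested with both [r] and [s] but crosses their
supremum, then some orientation of [t] lies above one of them and below the
inverse of the other, so that [r] and [s] are nested. *)
Lemma nested_join t r s :
  nested t r -> nested t s -> ~ nested r s -> nested t (join r s).
Proof.
move=> /nestedP tr /nestedP ts nrs; apply/nestedP.
case: tr => htr.
- by constructor 1; rewrite (le_trans htr) ?leUl.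
- case: ts => hts.
  + by constructor 1; rewrite (le_trans hts) ?leUr.
  + by constructor 2; rewrite le_invr leUx !(le_invr _ t) htr hts.
  + by constructor 3; rewrite (le_trans hts) ?leUr.
  + case: nrs; apply/nestedP; constructor 2; rewrite le_invr in htr.
    by rewrite (le_trans htr) // -le_inv invK.
- by constructor 3; rewrite (le_trans htr) ?leUl.
- case: ts => hts.
  + by constructor 1; rewrite (le_trans hts) ?leUr.
  + case: nrs; apply/nestedP; constructor 2; rewrite le_inv in htr.
    by rewrite (le_trans htr).
  + by constructor 3; rewrite (le_trans hts) ?leUr.
  + by constructor 4; rewrite le_inv leUx -!(le_inv t) htr hts.
Qed.

Definition corner r s c : Prop :=
  exists2 a, unor r a & exists2 b, unor s b & c = join a b.

Lemma nested_unorr t r a : unor r a -> nested t r -> nested t a.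
Proof. by case=> -> //; move/nested_inv. Qed.

Lemma nested_corner t r s c : corner r s c ->
  nested t r -> nested t s -> ~ nested r s -> nested t c.
Proof.
move=> [a ra [b sb ->]] tr ts nrs.
apply: nested_join; [exact: nested_unorr tr|exact: nested_unorr ts|].
move=> ab; apply: nrs; move: ab; rewrite /nested.
have -> : unor a = unor r by apply/unor_eqP.
by have -> : unor b = unor s by apply/unor_eqP.
Qed.

Lemma corner_nested r s c : corner r s c -> nested r c.
Proof.
case=> [a [] -> [b _ ->]]; apply/nestedP.
  by constructor 1; exact: leUl.
by constructor 3; exact: leUl.
Qed.

End Corners.

(** * Efficient distinguishers of regular profiles *)

Section SubmodularUniverses.
Context {R : realType} {d : Order.disp_t} {U : universeType d}.
Variable ord : U -> R.
Hypothesis ord_submodular : submodular_order ord.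
Implicit Types (r s t c : U) (P Q : set U) (k : R).
Local Notation join := Order.join.
Local Notation meet := Order.meet.
Local Notation eff := (distinguishes_efficiently ord).

Lemma ord_inv s : ord (inv s) = ord s.
Proof. by case: ord_submodular. Qed.

Definition regular_profile k P : Prop :=
  profile (sep_below ord k) P /\ regular P.

Lemma regular_profile_orientation k P :
  regular_profile k P -> regular_orientation (sep_below ord k) P.
Proof. by case=> -[]. Qed.

Lemma regular_profile_join k P r s : regular_profile k P ->
  P r -> P s -> ord (join r s) < k -> P (join r s).
Proof.
move=> hP Pr Ps lt.
have [//|] := ro_total (regular_profile_orientation hP) lt.
by case: hP => -[_ _ /(_ r s Pr Ps)].
Qed.

Lemma is_kappaP s P P' : distinguishes s P P' ->
  is_kappa ord P P' (ord s) <->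
  forall t, distinguishes t P P' -> ord s <= ord t.
Proof.
move=> ds; split=> [[_ lb] t dt|min]; first by apply: lb; exists t.
by split=> [|l [t tl /min st]]; [exists s|exact: le_trans tl].
Qed.

(** The minimum in kappa is taken over bounds on orders; a distinguisher attains it
just when it has least order among all distinguishers. *)
Lemma efficientP s P P' : eff s P P' <->
  distinguishes s P P' /\ forall t, distinguishes t P P' -> ord s <= ord t.
Proof. by split=> -[ds h]; split=> //; apply/(is_kappaP ds). Qed.

Lemma efficient_sym s P P' : eff s P P' -> eff s P' P.
Proof.
move=> /efficientP[ds min]; apply/efficientP; split; first exact: distinguishes_sym.
by move=> t /distinguishes_sym/min.
Qed.

Lemma efficient_inv s P P' : eff s P P' -> eff (inv s) P P'.
Proof.
move=> /efficientP[ds min]; apply/efficientP; rewrite ord_inv; split=> //.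
exact: distinguishes_inv.
Qed.

Lemma is_kappa_unique P P' k k' :
  is_kappa ord P P' k -> is_kappa ord P P' k' -> k = k'.
Proof. by move=> [h lb] [h' lb']; apply/eqP; rewrite eq_le lb // lb'. Qed.

Lemma is_kappa_efficient P P' k :
  is_kappa ord P P' k -> exists2 s, eff s P P' & ord s = k.
Proof.
move=> kk; have [[s sk ds] lb] := kk.
have e : ord s = k by apply/eqP; rewrite eq_le sk lb //; exists s.
by exists s => //; split=> //; rewrite e.
Qed.

(** The instance of robustness that compares [r] with a single [s]. *)
Definition robust_at P r s : Prop :=
  P r -> ord (meet (inv r) s) < ord r -> ord (meet (inv r) (inv s)) < ord r ->
  ~ (P (meet (inv r) s) /\ P (meet (inv r) (inv s))).

Lemma join_efficient k k' Q Q' r s :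
  regular_profile k Q -> regular_profile k' Q' -> eff s Q Q' ->
  Q s -> Q' (inv s) -> Q r -> ord (join r s) <= ord s -> eff (join r s) Q Q'.
Proof.
move=> hQ hQ' /efficientP[_ min] Qs Q's Qr le; apply/efficientP; split; last first.
  by move=> t /min; exact: le_trans.
have roQ := regular_profile_orientation hQ.
have roQ' := regular_profile_orientation hQ'.
apply: distinguishesI; first by case: hQ.
  by apply: (regular_profile_join hQ) => //; exact: le_lt_trans (ro_sub roQ Qs).
have lt' : ord s < k' by rewrite -ord_inv; exact: (ro_sub roQ' Q's).
apply: (ro_down roQ') Q's; last by rewrite le_inv leUr.
by rewrite /sep_below /= ord_inv; exact: le_lt_trans lt'.
Qed.

(** If the corner [join r s] is too large, then submodularity makes the opposite
corner too small to distinguish a pair that [r] distinguishes efficiently. *)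
Lemma meet_oriented_alike k k' P P' r s :
  regular_profile k P -> regular_profile k' P' -> eff r P P' ->
  P r -> P' (inv r) -> ord s < ord (join r s) ->
  ord (meet r s) < ord r /\ P' (meet r s).
Proof.
move=> hP hP' /efficientP[_ min] Pr P'r lt.
have roP := regular_profile_orientation hP.
have roP' := regular_profile_orientation hP'.
have ltm : ord (meet r s) < ord r.
  by case: ord_submodular => _ _ /(_ r s); move: lt; lra.
split=> //.
have lt' : ord r < k' by rewrite -ord_inv; exact: (ro_sub roP' P'r).
have [//|P'm] := ro_total roP' (lt_trans ltm lt' : sep_below ord k' (meet r s)).
have Pm : P (meet r s).
  by apply: (ro_down roP _ (leIl r s) Pr); exact: (lt_trans ltm (ro_sub roP Pr)).
by have := min _ (distinguishesI (proj2 hP) Pm P'm); rewrite leNgt ltm.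
Qed.

(** One of the corners [join r s] and [join r (inv s)] still distinguishes [Q] from
[Q'] efficiently.  Otherwise [meet r s] and [meet r (inv s)] have order less than
[r]; both lie in [P], hence both lie in [P'], and [P'] contains [inv r], contrary
to robustness. *)
Lemma exists_efficient_corner k k' l l' P P' Q Q' r s :
  regular_profile k P -> regular_profile k' P' ->
  regular_profile l Q -> regular_profile l' Q' ->
  eff r P P' -> P r -> P' (inv r) -> eff s Q Q' -> Q r -> Q' r ->
  robust_at P' (inv r) s ->
  exists2 c, corner r s c & eff c Q Q'.
Proof.
move=> hP hP' hQ hQ' er Pr P'r es Qr Q'r; rewrite /robust_at invK => rob.
wlog [Qs Q's] : l l' Q Q' hQ hQ' es Qr Q'r / Q s /\ Q' (inv s).
  move=> gen; have [/distinguishes_cases[h|[? ?]] _] := es; first exact: (gen l l').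
  have [||||||c cc ec] := gen l' l Q' Q => //; first exact: efficient_sym.
  by exists c => //; exact: efficient_sym.
have [le|lt] := leP (ord (join r s)) (ord s).
  exists (join r s); last exact: (join_efficient hQ hQ').
  by exists r; [left|exists s; [left|]].
have [le|lt'] := leP (ord (join r (inv s))) (ord (inv s)).
  exists (join r (inv s)).
    by exists r; [left|exists (inv s); [right|]].
  apply/efficient_sym/(join_efficient hQ' hQ) => //; rewrite ?invK //.
  exact/efficient_inv/efficient_sym.
have [lm P'm] := meet_oriented_alike hP hP' er Pr P'r lt.
have [lm' P'm'] := meet_oriented_alike hP hP' er Pr P'r lt'.
by case: rob; rewrite ?ord_inv.
Qed.

(** The exchange property that drives the construction: of two efficient
distinguishers, the one of larger order can be replaced, either by the other one
or by a corner of the two. *)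
Lemma efficient_or_corner k k' l l' P P' Q Q' r s :
  regular_profile k P -> regular_profile k' P' ->
  regular_profile l Q -> regular_profile l' Q' ->
  eff r P P' -> eff s Q Q' -> ord r <= ord s ->
  (forall r', unor r r' -> robust_at P r' s /\ robust_at P' r' s) ->
  eff r Q Q' \/ exists2 c, corner r s c & eff c Q Q'.
Proof.
move=> hP hP' hQ hQ' er es le rob.
have [ds mins] := proj1 (efficientP _ _ _) es.
have roQ := regular_profile_orientation hQ.
have roQ' := regular_profile_orientation hQ'.
have [Vr V'r] : sep_below ord l r /\ sep_below ord l' r.
  split; apply: (le_lt_trans le);
    case/distinguishes_cases: ds => -[/(ro_sub roQ) + /(ro_sub roQ')];
    by rewrite /sep_below /= ?ord_inv.
have minr t : distinguishes t Q Q' -> ord r <= ord t.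
  by move/mins; exact: le_trans.
have same r' : unor r r' -> Q r' -> Q' r' ->
    exists2 c, corner r s c & eff c Q Q'.
  move=> ur Qr Q'r.
  have er' : eff r' P P' by case: ur => ->//; exact: efficient_inv.
  have uir : unor r (inv r') by case: ur => ->; [right|left; rewrite invK].
  have -> : corner r s = corner r' s.
    by rewrite /corner; have -> : unor r' = unor r by apply/unor_eqP.
  have [robP robP'] := rob _ uir.
  have [/distinguishes_cases[[Pr P'r]|[Pr P'r]] _] := er'.
    exact: (exists_efficient_corner hP hP' hQ hQ').
  apply: (exists_efficient_corner hP' hP hQ hQ') => //.
  exact: efficient_sym.
have [Qr|Qr] := ro_total roQ Vr; have [Q'r|Q'r] := ro_total roQ' V'r.
- by right; apply: (same r) => //; left.
- left; apply/efficientP; split=> //.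
  by apply: distinguishesI => //; case: hQ.
- left; apply/efficientP; split=> //.
  by apply/distinguishes_sym/distinguishesI => //; case: hQ'.
- by right; apply: (same (inv r)) => //; right.
Qed.

(** * Choosing and counting efficient distinguishers *)

(** Private pairs are the edges of a forest on the profiles.  Split the profiles
along an element [s] of least order.  A private pair of another element [t] does
not cross this split: both its profiles orient [s], because |s| <= |t|, and if
they did so differently, then [s] would also distinguish the pair efficiently.
Induction applies to the two sides. *)
Lemma size_private_pairs (N : seq U) (ps : seq (set U)) :
  ps != [::] -> uniq N ->
  (forall P, P \in ps -> exists k, regular_profile k P) ->
  (forall s, s \in N -> exists P P', [/\ P \in ps, P' \in ps, eff s P P' &
     forall t, t \in N -> eff t P P' -> t = s]) ->
  (size N < size ps)%N.
Proof.
have [n] := ubnP (size N).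
elim: n N ps => // n IHn [|x N] ps lt ps0 uN prof priv.
  by rewrite lt0n size_eq0.
have [s sN smin] : exists2 s, s \in x :: N &
    forall t, t \in x :: N -> ord s <= ord t.
  elim: (N) (x) => [|y M IH] z.
    by exists z; rewrite ?mem_head // => t; rewrite inE => /eqP->.
  have [s sM smin] := IH y.
  have [le|le] := leP (ord z) (ord s).
    exists z => [|t]; first exact: mem_head.
    by rewrite inE => /orP[/eqP->//|/smin]; exact: le_trans.
  exists s; first by rewrite inE sM orbT.
  by move=> t; rewrite inE => /orP[/eqP->|/smin//]; exact: ltW.
move: (x :: N) lt uN priv sN smin => {x}{}N lt uN priv sN smin.
pose side (b : bool) := [pred P : set U | `[< P s >] == b].
pose private t P P' := eff t P P' /\ forall t', t' \in N -> eff t' P P' -> t' = t.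
pose Ns b := [pred t : U | (t != s) && `[< exists P P',
  [/\ P \in filter (side b) ps, P' \in filter (side b) ps & private t P P'] >]].
have sizes b : (size (filter (Ns b) N) < size (filter (side b) ps))%N.
  apply: IHn; rewrite ?filter_uniq //.
  - by rewrite (leq_trans (size_filter_lt sN _)) //= eqxx.
  - have [P [P' [Pps P'ps [ds _] _]]] := priv s sN.
    have [k /regular_profile_orientation roP] := prof P Pps.
    have [k' /regular_profile_orientation roP'] := prof P' P'ps.
    suff [Q Qps Qb] : exists2 Q, Q \in ps & side b Q.
      apply/negP => /eqP e.
      have : Q \in [seq x <- ps | side b x] by rewrite mem_filter Qb.
      by rewrite e.
    case/distinguishes_cases: ds => -[Ps P's]; case: b.
    + by exists P => //; apply/eqP/asboolT.
    + by exists P' => //; apply/eqP/asboolF => /(ro_excl roP').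
    + by exists P' => //; apply/eqP/asboolT.
    + by exists P => //; apply/eqP/asboolF => /(ro_excl roP).
  - by move=> P; rewrite mem_filter => /andP[_ /prof].
  - move=> t; rewrite mem_filter => /andP[/andP[_ /asboolP[P [P' tP]]] _].
    case: tP => iP iP' [et pt].
    exists P, P'; split=> // t'; rewrite mem_filter => /andP[_]; exact: pt.
have cover :
    (size N <= (size (filter (Ns true) N) + size (filter (Ns false) N)).+1)%N.
  rewrite !size_filter -(count_predC (pred1 s)) count_uniq_mem // sN add1n ltnS.
  rewrite -count_predUI (leq_trans _ (leq_addr _ _)) // eq_leq //.
  apply: eq_in_count => t tN /=; have [//|/= ts] := boolP (t == s).
  apply/esym; have [P [P' [Pps P'ps et pt]]] := priv t tN.
  have [k /regular_profile_orientation roP] := prof P Pps.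
  have [k' /regular_profile_orientation roP'] := prof P' P'ps.
  have [dt mint] := proj1 (efficientP _ _ _) et.
  have le := smin t tN.
  have ndist : ~ distinguishes s P P'.
    move=> ds; case/eqP: ts; apply/esym/pt => //; apply/efficientP; split=> //.
    by move=> t' /mint; exact: le_trans.
  have [Vs V's] : sep_below ord k s /\ sep_below ord k' s.
    by split; apply: (le_lt_trans le); case/distinguishes_cases: dt => -[];
      move=> /(ro_sub roP) + /(ro_sub roP'); rewrite /sep_below /= ?ord_inv.
  have alike : `[< P s >] = `[< P' s >].
    apply/asbool_equiv_eq; split=> h.
      have [//|P's] := ro_total roP' V's.
      case: ndist; apply: distinguishesI => //; by case: roP.
    have [//|Ps] := ro_total roP Vs.
    by case: ndist; apply/distinguishes_sym/distinguishesI => //; case: roP'.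
  have in_side : `[< exists P0 P'0, [/\ P0 \in filter (side `[< P s >]) ps,
      P'0 \in filter (side `[< P s >]) ps & private t P0 P'0] >].
    by apply/asboolP; exists P, P'; rewrite !mem_filter /= -alike eqxx Pps P'ps.
  by apply/orP; case: `[< P s >] in_side => h; [left|right].
rewrite (size_filter_split (fun P : set U => `[< P s >]) ps).
apply: leq_trans (leq_add (sizes true) (sizes false)).
by rewrite addSn addnS ltnS.
Qed.

(** With the indices sorted by [w], an index that comes later can always exchange
its element [s].  A best candidate [s] crosses nothing, since an exchange for a
corner of [r] and [s] keeps it nested with all that [s] is nested with and makes
it nested with [r], while an exchange for [r] itself ends the search at once. *)
Lemma nested_transversal (I : eqType) (A : I -> set U) (w : I -> R) (js : seq I) :
  (forall j, j \in js -> A j !=set0) ->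
  (forall i j r s, i \in js -> j \in js -> w i <= w j -> A i r -> A j s ->
     ~ nested r s -> A j r \/ exists2 c, corner r s c & A j c) ->
  exists N : seq U, [/\ forall r s, r \in N -> s \in N -> nested r s,
    forall s, s \in N -> exists2 j, j \in js & A j s
    & forall j, j \in js -> exists2 s, s \in N & A j s].
Proof.
(* Induction on lists adds elements at the head, so the largest come first. *)
pose ge_w i j := w j <= w i.
have ge_tr : transitive ge_w by move=> a b c ab bc; exact: le_trans ab.
have ge_tot : total ge_w by move=> a b; exact: le_total.
suff sorted_case ls : sorted ge_w ls -> (forall j, j \in ls -> A j !=set0) ->
    (forall i j r s, i \in ls -> j \in ls -> w i <= w j -> A i r -> A j s ->
     ~ nested r s -> A j r \/ exists2 c, corner r s c & A j c) ->
    exists N : seq U, [/\ forall r s, r \in N -> s \in N -> nested r s,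
      forall s, s \in N -> exists2 j, j \in ls & A j s
      & forall j, j \in ls -> exists2 s, s \in N & A j s].
  move=> ne spl; have [|||N [nest src hit]] := sorted_case (sort ge_w js).
  - exact: sort_sorted.
  - by move=> j; rewrite mem_sort; exact: ne.
  - by move=> i j r s; rewrite !mem_sort; exact: spl.
  exists N; split=> //.
    by move=> s /src[j]; rewrite mem_sort; exists j.
  by move=> j jj; apply: hit; rewrite mem_sort.
elim: ls => [|j ls IH] srt ne spl; first by exists [::].
have [||N [nest src hit]] := IH (path_sorted srt).
- by move=> i il; apply: ne; rewrite inE il orbT.
- by move=> i i' r s il i'l; apply: spl; rewrite inE ?il ?i'l orbT.
have jmax := order_path_min ge_tr srt.
suff [s As sN] : exists2 s, A j s & forall r, r \in N -> nested r s.
  exists (s :: N); split.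
  - move=> a b; rewrite !inE => /orP[/eqP->|aN] /orP[/eqP->|bN].
    + exact: nested_refl.
    + exact/nested_sym/sN.
    + exact: sN.
    + exact: nest.
  - move=> a; rewrite inE => /orP[/eqP->|/src[i il Ai]].
      by exists j => //; rewrite mem_head.
    by exists i => //; rewrite inE il orbT.
  - move=> i; rewrite inE => /orP[/eqP->|/hit[a aN Aa]].
      by exists s => //; rewrite mem_head.
    by exists a => //; rewrite inE aN orbT.
have [s0 As0] := ne j (mem_head _ _).
pose crosses s := [pred r : U | ~~ `[< nested r s >]].
have [n] := ubnP (count (crosses s0) N); elim: n s0 As0 => // n IHn s As lt.
have [/hasP[r rN /asboolPn nrs]|/hasPn none] := boolP (has (crosses s) N);
  last by exists s => // r /none /negPn/asboolP.
have [i il Air] := src r rN.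
have wij : w i <= w j by exact: (allP jmax).
have il' : i \in j :: ls by rewrite inE il orbT.
have [Ajr|[c cc Ac]] := spl i j r s il' (mem_head _ _) wij Air As nrs.
  by exists r => // x xN; exact: nest.
apply: (IHn c Ac).
rewrite -ltnS (leq_trans _ lt) // ltnS.
have sub x : x \in N -> crosses c x -> crosses s x.
  move=> xN /asboolPn nxc; apply/asboolPn => xs; apply: nxc.
  by apply: (nested_corner cc) => //; exact: nest.
have eqc : count (crosses c) N = count (predI (crosses c) (crosses s)) N.
  apply: eq_in_count => x xN /=; case: (boolP `[< nested x c >]) => //= h.
  by have /= -> := sub x xN h.
rewrite eqc -count_filter -(size_filter (crosses s)) -size_filter.
apply: (@size_filter_lt _ _ _ r).
  by rewrite mem_filter rN andbT; apply/asboolPn.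
by rewrite /= negbK; apply/asboolP/(corner_nested cc).
Qed.

Lemma robust_at_efficient (PP : set (set U)) P P' Q Q' r s :
  robust ord PP -> PP P -> PP P' -> P <> P' -> PP Q -> PP Q' -> Q <> Q' ->
  eff r P P' -> eff s Q Q' -> robust_at P r s.
Proof.
move=> [_ [sub1|[m [_ mmax] rob]]] PPP PPP' ne PPQ PPQ' ne' [_ kr] [_ ks].
  by case: ne; exact: sub1.
move=> Pr lt lt'; have ordr : ord r < ord r + 1 by rewrite ltrDl.
have [[_ [k kk [robP _]]] _] := rob _ _ PPP PPP' ne.
rewrite (is_kappa_unique kk kr) in robP => -[Pm Pm'].
apply: (robP r s _ _ lt lt').
- by split.
- by rewrite (le_lt_trans (mmax _ _)) ?ltrDl //; exists Q, Q'.
- by split; split=> //; [exact: lt_trans ordr|exact: lt_trans ordr].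
Qed.

(** A set of least size that is nested and efficiently distinguishes all pairs
gives each of its elements a private pair: a pair that is no longer efficiently
distinguished once this element has been left out. *)
Lemma exists_efficient_nested (PP : set (set U)) (ps : seq (set U)) :
  PP = [set` ps] -> ps != [::] ->
  (forall P, PP P -> exists k, regular_profile k P) -> robust ord PP ->
  exists N : seq U, [/\ forall r s, r \in N -> s \in N -> nested r s,
    forall s, s \in N -> exists P P', [/\ PP P, PP P', P <> P' & eff s P P'],
    forall P P', PP P -> PP P' -> P <> P' -> exists2 s, s \in N & eff s P P'
    & (size N < size ps)%N].
Proof.
move=> PPE ps0 prof rob.
have psP P : P \in ps <-> PP P by rewrite PPE.
pose good N := [/\ uniq N, forall r s, r \in N -> s \in N -> nested r s,
    forall s, s \in N -> exists P P', [/\ PP P, PP P', P <> P' & eff s P P']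
    & forall P P', PP P -> PP P' -> P <> P' -> exists2 s, s \in N & eff s P P'].
have [N0 goodN0] : exists N, good N.
  pose js := [seq e <- [seq (P, P') | P <- ps, P' <- ps] | e.1 != e.2].
  have jsP e : e \in js <-> [/\ PP e.1, PP e.2 & e.1 <> e.2].
    rewrite mem_filter; split=> [/andP[/eqP ne /allpairsP[p [p1 p2 ee]]]|[p1 p2 ne]].
      by move: ne; rewrite ee /= => ne; split=> //; exact/psP.
    apply/andP; split; first exact/eqP.
    by apply/allpairsP; exists e; split; [exact/psP|exact/psP|case: e {p1 p2 ne}].
  have hasE e : e \in js -> exists s, eff s e.1 e.2.
    move=> /jsP[p1 p2 ne]; case: rob => _ [sub1|[m _ rob]].
      by case: ne; exact: sub1.
    have [[_ [k /is_kappa_efficient[s es _] _]] _] := rob _ _ p1 p2 ne.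
    by exists s.
  have [w wP] : {w : set U * set U -> R &
      forall e, e \in js -> forall s, eff s e.1 e.2 -> ord s = w e}.
    pose kappaE e k := e \in js -> forall s, eff s e.1 e.2 -> ord s = k.
    apply: (@choice _ _ kappaE) => e; have [/hasE[s es]|nj] := boolP (e \in js).
      exists (ord s) => _ t et.
      exact: (is_kappa_unique (proj2 et) (proj2 es)).
    by exists 0 => ej; case/negP: nj.
  have [||N [nest src hit]] :=
    @nested_transversal _ (fun e => [set s | eff s e.1 e.2]) w js.
  - by move=> e /hasE.
  - move=> e f r s ej fj le er es _.
    have [p1 p2 ne] := (jsP _).1 ej; have [q1 q2 ne'] := (jsP _).1 fj.
    have [[k hP] [k' hP'] [l hQ] [l' hQ']] :
        [/\ exists k, regular_profile k e.1, exists k, regular_profile k e.2,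
            exists k, regular_profile k f.1 & exists k, regular_profile k f.2].
      by split; exact: prof.
    apply: (efficient_or_corner hP hP' hQ hQ' er es).
      by rewrite (wP _ ej _ er) (wP _ fj _ es).
    move=> r' ur.
    have er' : eff r' e.1 e.2 by case: ur => ->//; exact: efficient_inv.
    split; first exact: (robust_at_efficient rob p1 p2 ne q1 q2 ne' er' es).
    by apply: (robust_at_efficient rob p2 p1 _ q1 q2 ne' _ es);
      [exact/nesym|exact: efficient_sym].
  exists (undup N); split; first exact: undup_uniq.
  + by move=> r s; rewrite !mem_undup; exact: nest.
  + by move=> s; rewrite mem_undup => /src[e /jsP[p1 p2 ne] es]; exists e.1, e.2.
  + move=> P P' PPP PPP' ne; have [|s sN es] := hit (P, P'); first exact/jsP.
    by exists s; rewrite ?mem_undup.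
have exn : exists n, `[< exists2 N, good N & size N = n >].
  by exists (size N0); apply/asboolP; exists N0.
case: (ex_minnP exn) => _ /asboolP[N goodN <-] minN.
have [uN nest src hit] := goodN.
exists N; split=> //; apply: size_private_pairs => //.
  by move=> P /psP/prof.
move=> s sN; apply: contrapT => npriv.
(* Without a private pair, [s] could be left out. *)
have goodN' : good (filter (predC1 s) N).
  split; first exact: filter_uniq.
  - by move=> x y; rewrite !mem_filter => /andP[_ xN] /andP[_ yN]; exact: nest.
  - by move=> x; rewrite mem_filter => /andP[_ /src].
  - move=> P P' PPP PPP' ne; apply: contrapT => none.
    have other t : t \in N -> eff t P P' -> t = s.
      move=> tN et; apply: contrapT => /eqP ts.
      by apply: none; exists t; rewrite // mem_filter /= ts.
    have [t tN et] := hit P P' PPP PPP' ne.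
    apply: npriv; exists P, P'; split; [exact/psP|exact/psP| |exact: other].
    by rewrite -(other t tN et).
have : (size N <= size (filter (predC1 s) N))%N.
  by apply: minN; apply/asboolP; exists (filter (predC1 s) N).
by rewrite leqNgt (size_filter_lt sN) //= eqxx.
Qed.

Lemma exists_largest_profile (ps : seq (set U)) :
  ps != [::] -> (forall P, P \in ps -> exists k, regular_profile k P) ->
  exists P k, regular_profile k P /\
    forall P', P' \in ps -> exists2 l, regular_profile l P' & l <= k.
Proof.
elim: ps => // P [|P1 ps] IH _ prof; have [l hP] := prof P (mem_head _ _).
  by exists P, l; split=> // P'; rewrite inE => /eqP->; exists l.
have [//||Q [k [hQ kmax]]] := IH.
  by move=> P' P'ps; apply: prof; rewrite inE P'ps orbT.
have [le|lt] := leP l k.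
  by exists Q, k; split=> // P'; rewrite inE => /orP[/eqP->|/kmax//]; exists l.
exists P, l; split=> // P'; rewrite inE => /orP[/eqP->|/kmax[l' hP' le]].
  by exists l.
by exists l' => //; rewrite (le_trans le) ?ltW.
Qed.

Lemma efficient_not_small s P P' k k' :
  regular_profile k P -> regular_profile k' P' -> eff s P P' ->
  ~ small s /\ ~ small (inv s).
Proof.
move=> [_ reg] [_ reg'] [/distinguishes_cases[[Ps P's]|[Ps P's]] _].
  by split; [rewrite -(invK s); exact: reg'|exact: reg].
by split; [rewrite -(invK s); exact: reg|exact: reg'].
Qed.

Lemma efficient_order_lt s P P' k :
  regular_profile k P -> eff s P P' -> ord s < k.
Proof.
move=> /regular_profile_orientation roP [/distinguishes_cases ds _].
by case: ds => -[/(ro_sub roP) + _]; rewrite /sep_below /= ?ord_inv.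
Qed.

End SubmodularUniverses.

(** * The tree set *)

Theorem theorem3p9 (R : realType) (d : Order.disp_t) (U : universeType d)
    (ord : U -> R) (ord_submodular : submodular_order ord)
    (PP : set (set U)) (PP_finite : finite_set PP) (PP_nonempty : PP !=set0)
    (PP_profiles : forall P, PP P -> profile_in_universe ord P /\ regular P)
    (PP_robust : robust ord PP) :
  exists T : set (set U),
    [/\ regular_tree_set T,
        forall P P', PP P -> PP P' -> P <> P' ->
          exists2 s, T (unor s) & distinguishes_efficiently ord s P P',
        forall T0, T0 `<` T -> ~ distinguishes_set T0 PP
      & exists f : set U -> set U,
          (forall P, PP P ->
             unique (fun O => consistent_orientations T O /\
                              P `&` orientations T `<=` O) (f P)) /\
          set_bij PP (consistent_orientations T) f].
Proof.
have [ps [ups PPE]] : exists ps : seq (set U), uniq ps /\ PP = [set` ps].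
  have /finite_seqP[ps ->] := PP_finite; exists (undup ps).
  split; first exact: undup_uniq.
  by apply/seteqP; split=> P /=; rewrite mem_undup.
have psP P : P \in ps <-> PP P by rewrite PPE.
have ps0 : ps != [::].
  by case: PP_nonempty => P /psP; case: (ps).
have prof P : PP P -> exists k, regular_profile ord k P.
  by move=> /PP_profiles[[k _ hP] reg]; exists k%:R; split.
have [N [nest src hit sizeN]] :=
  exists_efficient_nested ord_submodular PPE ps0 prof PP_robust.
pose T := [set unor s | s in [set` N]].
have TP s : T (unor s) <-> s \in N \/ inv s \in N.
  split=> [[t tN /unor_eqP[<-|e]]|[sN|sN]]; [by left| |by exists s|].
    by right; rewrite -e.
  by exists (inv s) => //; rewrite unor_inv.
pose V := orientations T.
have NV s : s \in N -> V s by move=> sN; apply/TP; left.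
have Vinv s : V s -> V (inv s) by rewrite /V /orientations /= unor_inv.
have Vreg s : V s -> ~ small s.
  move=> /TP[] /src[P [P' [/prof[k hP] /prof[k' hP'] _ es]]].
    by case: (efficient_not_small hP hP' es).
  by rewrite -(invK s); case: (efficient_not_small hP hP' es).
have nestV r s : V r -> V s -> nested r s.
  have inv1 x y : nested (inv x) y <-> nested x y by rewrite /nested unor_inv.
  by move=> /TP[rN|rN] /TP[sN|sN]; [|apply/nested_inv|apply/inv1|
    apply/inv1/nested_inv]; exact: nest.
have [P0 [k0 [/regular_profile_orientation roP0 kmax]]] :=
  exists_largest_profile ps0 (fun P Pps => prof P ((psP P).1 Pps)).
(* The profile [P0] with the largest parameter orients all of [T], as each
   element of [T] has order less than the parameter of some profile in [PP]. *)
have VP s : V s -> ord s < k0.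
  move=> Vs; have [t tN ->] : exists2 t, t \in N & ord s = ord t.
    by case/TP: Vs; [exists s|exists (inv s); rewrite ?ord_inv].
  have [P [P' [/psP/kmax[l hP le] _ _ et]]] := src t tN.
  exact: lt_le_trans (efficient_order_lt ord_submodular hP et) le.
pose f P := extension P0 P V.
have fro P : PP P -> regular_orientation V (f P).
  move=> /prof[k /regular_profile_orientation roP].
  exact: (extension_orientation roP0 roP).
have fsub P : P `&` V `<=` f P by exact: extension_sub.
have coE O : consistent_orientations T O <-> regular_orientation V O.
  split=> [[oO cO]|[oO cO _]] //; split=> // s Os.
  by apply/Vreg/Vinv; case: oO => + _ _; apply.
have dist_f P P' s : PP P -> PP P' -> V s -> distinguishes s P P' ->
    distinguishes s (f P) (f P').
  have oriented Q Q' t : PP Q -> PP Q' -> V t -> Q t -> Q' (inv t) ->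
      distinguishes t (f Q) (f Q').
    move=> PPQ PPQ' Vt Qt Q't; apply: distinguishesI; first by case: (fro Q PPQ).
      exact: fsub.
    by apply: fsub; split=> //; exact: Vinv.
  move=> PPP PPP' Vs /distinguishes_cases[[Ps P's]|[Ps P's]]; first exact: oriented.
  exact/distinguishes_sym/oriented.
have f_inj P P' : PP P -> PP P' -> f P = f P' -> P = P'.
  move=> PPP PPP' e; apply: contrapT => /(hit P P' PPP PPP')[s sN [ds _]].
  apply: (@not_distinguishes_self _ _ _ _ s (fro P PPP)); rewrite {2}e.
  exact: dist_f (NV s sN) ds.
have ufps : uniq (map f ps).
  by rewrite map_inj_in_uniq // => P P' /psP PPP /psP PPP'; exact: f_inj.
have fps_ro O : O \in map f ps -> regular_orientation V O.
  by move=> /mapP[P /psP PPP ->]; exact: fro.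
(* An orientation outside the image of [f] would be one more than the at most
   |N| + 1 <= |PP| that a nested set of size |N| can have. *)
have f_surj O : consistent_orientations T O -> exists2 P, PP P & f P = O.
  move=> /coE roO; apply: contrapT => nf.
  have nO : O \notin map f ps.
    by apply/mapP => -[P /psP PPP e]; apply: nf; exists P.
  suff : (size (O :: map f ps) <= (size N).+1)%N.
    by rewrite /= size_map ltnS leqNgt sizeN.
  have all_ro O' : O' \in O :: map f ps -> regular_orientation V O'.
    by rewrite inE => /orP[/eqP->//|/fps_ro].
  apply: (@size_consistent_orientations _ _ V) => //; first by rewrite /= nO.
  move=> O1 O2 /all_ro ro1 /all_ro ro2.
  move=> /(distinct_orientations_distinguished ro1 ro2)[s /TP[sN ds|sN ds]].
    by exists s.
  by exists (inv s) => //; exact: distinguishes_inv.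
exists T; split.
- split; last exact: Vreg.
  split; first by move=> _ [s _ <-]; exists s.
    exact: nestV.
  move=> s Vs; split=> [e|[_ [t Vt [/ltW st /ltW st']]]]; apply: (Vreg s Vs).
    by rewrite /small -e.
  by rewrite /small (le_trans st) // le_invr.
- by move=> P P' PPP PPP' /(hit P P' PPP PPP')[s sN es]; exists s => //; exact: NV.
- move=> T0 [T0T /existsNP[_ /not_implyP[[s0 s0N <-] nT0]]] dist.
  pose N0 := filter (fun s => `[< T0 (unor s) >]) N.
  have lt : (size N0 < size N)%N.
    by apply: (size_filter_lt s0N); apply/asboolPn.
  (* [T0] would distinguish the |PP| orientations in the image of [f] with fewer
     than |PP| - 1 elements. *)
  suff : (size (map f ps) <= (size N0).+1)%N.
    by rewrite size_map leqNgt (leq_ltn_trans lt sizeN).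
  apply: (@size_consistent_orientations _ _ V) => //.
  + by move=> r s; rewrite !mem_filter => /andP[_ rN] /andP[_ sN]; exact: nest.
  + by move=> s; rewrite mem_filter => /andP[_ /NV].
  + move=> _ _ /mapP[P /psP PPP ->] /mapP[P' /psP PPP' ->] ne.
    have [|s T0s ds] := dist P P' PPP PPP'; first by move=> e; apply: ne; rewrite e.
    have Vs : V s by exact: T0T.
    case/TP: (Vs) => sN.
      by exists s; [rewrite mem_filter sN andbT; exact/asboolP|exact: dist_f].
    exists (inv s); last exact/distinguishes_inv/dist_f.
    by rewrite mem_filter sN andbT; apply/asboolP; rewrite unor_inv.
- exists f; split=> [P PPP|].
    split=> [|O [/f_surj[P' PPP' <-] sub]].
      by split; [exact/coE/fro|exact: fsub].
    congr f; apply: contrapT => /(hit P P' PPP PPP')[s sN [ds _]].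
    have roP' := fro P' PPP'.
    case/distinguishes_cases: ds => -[Ps P's].
      apply: (ro_excl roP' (s := s)); first by apply: sub; split=> //; exact: NV.
      by apply: fsub; split=> //; exact/Vinv/NV.
    apply: (ro_excl roP' (s := s)); first by apply: fsub; split=> //; exact: NV.
    by apply: sub; split=> //; exact/Vinv/NV.
  split.
  + by move=> P PPP; exact/coE/fro.
  + by move=> P P' /set_mem PPP /set_mem PPP'; exact: f_inj.
  + by move=> O /f_surj[P PPP <-]; exists P.
Qed.
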